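(* If $v({\rm SDP})>v({\rm UQ})$, then $v({\rm SDP})=v({\rm LP})<+\infty$.
   Context: Let $n,p\ge1$, $a_0,a_1,\dots,a_p\in\mathbb{R}^n$ and $b_1,\dots,b_p\in\mathbb{R}$. The uniform quadratic optimization problem is $$({\rm UQ})\quad \max\ f_0(x)=x^Tx-2a_0^Tx\quad\text{s.t. } x\in\Omega_1:=\{x\in\mathbb{R}^n: x^Tx-2a_i^Tx+b_i\le 0,\ i=1,\dots,p\}.$$ Standing assumption (Slater's condition): $\Omega_1$ has nonempty interior. Its semidefinite relaxation, with variables $x\in\mathbb{R}^n$ and $Y$ a real symmetric $n\times n$ matrix, is $$({\rm SDP})\quad \max\ {\rm Tr}(Y)-2a_0^Tx\quad\text{s.t. } {\rm Tr}(Y)-2a_i^Tx+b_i\le 0,\ i=1,\dots,p,\qquad \begin{pmatrix} Y & x \\ x^T & 1 \end{pmatrix}\succeq 0,$$ where $\succeq0$ means positive semidefinite. Its linear programming relaxation, with variables $x\in\mathbb{R}^n$, $y\in\mathbb{R}$, is $$({\rm LP})\quad \max\ y-2a_0^Tx\quad\text{s.t. } y-2a_i^Tx+b_i\le 0,\ i=1,\dots,p.$$ $v(\cdot)$ denotes the optimal value of a problem ($+\infty$ if unbounded). *)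

(* Defs.v *)
From HB Require Import structures.
From mathcomp Require Import all_boot all_order all_algebra.
From mathcomp Require Import all_classical all_reals all_analysis.
Import Order.TTheory GRing.Theory Num.Theory.
Import numFieldNormedType.Exports.

Set Implicit Arguments.
Unset Strict Implicit.
Unset Printing Implicit Defensive.

Local Open Scope classical_set_scope.
Local Open Scope ring_scope.

(* Throughout, the constraints i = 1..p are indexed by 'I_p, and the optimal
   value of a maximization problem is the supremum of its objective in \bar R,
   so it is +oo for an unbounded problem and -oo for an infeasible one. *)

Definition dotv (R : realType) (n : nat) (u v : 'cV[R]_n) : R :=
  (u^T *m v) 0 0.

Definition psdmx (R : realType) (m : nat) (M : 'M[R]_m) : Prop :=
  M \is symmetricmx /\ forall z : 'cV[R]_m, 0 <= (z^T *m M *m z) 0 0.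

Section Problems.
Variables (R : realType) (n p : nat).
Variables (a0 : 'cV[R]_n) (a : 'I_p -> 'cV[R]_n) (b : 'I_p -> R).

Definition Omega1 : set 'cV[R]_n :=
  [set x | forall i, dotv x x - 2 * dotv (a i) x + b i <= 0].

Definition UQ_objective (x : 'cV[R]_n) : R := dotv x x - 2 * dotv a0 x.

Definition UQ_value : \bar R :=
  ereal_sup [set (UQ_objective x)%:E | x in Omega1].

Definition SDP_feasible : set ('cV[R]_n * 'M[R]_n) :=
  [set w | [/\ w.2 \is symmetricmx,
    forall i, \tr w.2 - 2 * dotv (a i) w.1 + b i <= 0
    & psdmx (block_mx w.2 w.1 w.1^T (1%:M : 'M[R]_1))]].

Definition SDP_objective (w : 'cV[R]_n * 'M[R]_n) : R :=
  \tr w.2 - 2 * dotv a0 w.1.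

Definition SDP_value : \bar R :=
  ereal_sup [set (SDP_objective w)%:E | w in SDP_feasible].

Definition LP_feasible : set ('cV[R]_n * R) :=
  [set w | forall i, w.2 - 2 * dotv (a i) w.1 + b i <= 0].

Definition LP_objective (w : 'cV[R]_n * R) : R := w.2 - 2 * dotv a0 w.1.

Definition LP_value : \bar R :=
  ereal_sup [set (LP_objective w)%:E | w in LP_feasible].

End Problems.

(* Main.v *)
(** The pair [(x, Y)] enters (SDP) only through [(x, Tr Y)], and the
    semidefinite constraint amounts to [x^T x <= Tr Y].  Take an (SDP) point
    whose objective exceeds v(UQ); it satisfies [x^T x < Tr Y], as otherwise [x]
    would be feasible for (UQ).  If some (LP) point with objective above v(UQ)
    had [y < x^T x], the segment joining the two would cross the paraboloid
    [y = x^T x] at a (UQ) point with objective above v(UQ).  Hence every (LP)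
    point with objective above v(UQ) is feasible for (SDP).  Finiteness holds
    because [x^T x <= y <= 2 a_i^T x - b_i] keeps [x] bounded. *)
Require Import Defs.
From mathcomp Require Import all_boot all_order all_algebra.
From mathcomp Require Import all_classical all_reals all_analysis.
From mathcomp Require Import ring lra.
Import Order.TTheory GRing.Theory Num.Theory.
Import numFieldNormedType.Exports.

Local Open Scope classical_set_scope.
Local Open Scope ring_scope.

Lemma symmetricmxP (R : realType) (m : nat) (M : 'M[R]_m) :
  reflect (M^T = M) (M \is symmetricmx).
Proof.
rewrite is_hermitianmxE expr0 scale1r map_mx_id // eq_sym.
exact: eqP.
Qed.

Section DotProduct.
Context {R : realType} {n : nat}.
Implicit Types (u v w x : 'cV[R]_n) (c : R).

Lemma dotvE u v : dotv u v = \sum_i u i 0 * v i 0.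
Proof. by rewrite /dotv mxE; apply: eq_bigr => i _; rewrite mxE. Qed.

Lemma dotvC u v : dotv u v = dotv v u.
Proof. by rewrite !dotvE; apply: eq_bigr => i _; rewrite mulrC. Qed.

Lemma dotvDr u v w : dotv u (v + w) = dotv u v + dotv u w.
Proof. by rewrite /dotv mulmxDr mxE. Qed.

Lemma dotvZr c u v : dotv u (c *: v) = c * dotv u v.
Proof. by rewrite /dotv -scalemxAr mxE. Qed.

Lemma dotvDl u v w : dotv (u + v) w = dotv u w + dotv v w.
Proof. by rewrite dotvC dotvDr !(dotvC w). Qed.

Lemma dotvZl c u v : dotv (c *: u) v = c * dotv u v.
Proof. by rewrite dotvC dotvZr dotvC. Qed.

Lemma dotv_ge0 u : 0 <= dotv u u.
Proof. by rewrite dotvE; apply: sumr_ge0 => i _; rewrite -expr2 sqr_ge0. Qed.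

(** Expand [|2 u - v|^2 >= 0]. The weight [2^-1] on [v] lets half of a square norm be absorbed when
    (SDP) is bounded. *)
Lemma dotv_le_sqr u v : 2 * dotv u v <= 2 * dotv u u + 2^-1 * dotv v v.
Proof.
have := dotv_ge0 (2 *: u + (-1) *: v).
rewrite dotvDl !dotvDr !dotvZl !dotvZr (dotvC v u); lra.
Qed.

Lemma tr_outer x : \tr (x *m x^T) = dotv x x.
Proof. by rewrite mxtrace_mulC trace_mx11. Qed.

(** Keeping [s] a 1 by 1 matrix lets every test vector be split as [col_mx u s]. *)
Lemma quad_block (Y : 'M[R]_n) x u (s : 'M[R]_1) :
  (((col_mx u s)^T *m block_mx Y x x^T 1%:M *m col_mx u s) 0 0)
  = (u^T *m Y *m u) 0 0 + 2 * (dotv u x * s 0 0) + s 0 0 ^+ 2.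
Proof.
have addE (A B : 'M[R]_1) : (A + B) 0 0 = A 0 0 + B 0 0 by rewrite mxE.
have mulE (A B : 'M[R]_1) : (A *m B) 0 0 = A 0 0 * B 0 0 by rewrite mxE big_ord1.
rewrite tr_col_mx mul_row_block mul_row_col mulmx1 !mulmxDl -(mulmxA s^T).
rewrite !addE !mulE [s^T 0 0]mxE -/(dotv u x) -/(dotv x u) (dotvC x u); ring.
Qed.

Lemma psd_block_le_trace (Y : 'M[R]_n) x :
  psdmx (block_mx Y x x^T (1%:M : 'M[R]_1)) -> dotv x x <= \tr Y.
Proof.
move=> [_ psdY]; rewrite dotvE; apply: ler_sum => i _.
(* The test vector [(e_i, - x_i)] gives [Y_ii - x_i^2 >= 0]; summing over [i] yields the trace
   bound. *)
have := psdY (col_mx (delta_mx i 0) (- x i 0)%:M).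
rewrite quad_block [X in X + _ + _](_ : _ = Y i i); last first.
  by rewrite trmx_delta -rowE -colE !mxE.
have -> : dotv (delta_mx i 0) x = x i 0.
  by rewrite /dotv trmx_delta -rowE mxE.
rewrite !mxE /=; nra.
Qed.

(** Spread the slack [y - x^T x] evenly over the diagonal: [Y = x x^T + c I]. The block form at
    [(u, s)] is then [(u^T x + s)^2 + c |u|^2]. *)
Lemma psd_block_exists x (y : R) : (0 < n)%N -> dotv x x <= y ->
  exists Y : 'M[R]_n, [/\ Y \is symmetricmx, \tr Y = y
    & psdmx (block_mx Y x x^T (1%:M : 'M[R]_1))].
Proof.
move=> n_gt0 le_xy; pose c := (y - dotv x x) / n%:R.
have c_ge0 : 0 <= c by rewrite divr_ge0 ?subr_ge0.
have symY : (x *m x^T + c%:M)^T = x *m x^T + c%:M.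
  by rewrite linearD /= trmx_mul trmxK tr_scalar_mx.
exists (x *m x^T + c%:M); split.
- by apply/symmetricmxP; rewrite symY.
- rewrite linearD /= tr_outer mxtrace_scalar -mulr_natr /c.
  by rewrite divfK ?pnatr_eq0 -?lt0n // addrC subrK.
split; first by apply/symmetricmxP; rewrite tr_block_mx symY trmxK trmx1.
move=> z; rewrite -[z]vsubmxK quad_block.
set u := usubmx z; set s := dsubmx z.
have -> : (u^T *m (x *m x^T + c%:M) *m u) 0 0 = dotv u x ^+ 2 + c * dotv u u.
  rewrite mulmxDr mulmxDl mul_mx_scalar -scalemxAl mulmxA -mulmxA mxE.
  congr (_ + _); last by rewrite mxE.
  by rewrite mxE big_ord1 -/(dotv u x) -/(dotv x u) (dotvC x u).
have := mulr_ge0 c_ge0 (dotv_ge0 u); have := sqr_ge0 (dotv u x + s 0 0).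
by rewrite sqrrD; lra.
Qed.

(** Intermediate value theorem for [q(t) = |x(t)|^2 - y(t)] along the segment, a polynomial in [t]
    with [q(0) <= 0 <= q(1)]. *)
Lemma segment_paraboloid x1 x2 (y1 y2 : R) :
  dotv x1 x1 <= y1 -> y2 <= dotv x2 x2 ->
  exists2 t : R, 0 <= t <= 1 &
    let x := (1 - t) *: x1 + t *: x2 in
    dotv x x = (1 - t) * y1 + t * y2.
Proof.
move=> le1 le2; pose q : {poly R} :=
  ((1 - 'X) ^+ 2 * (dotv x1 x1)%:P + 2%:P * (1 - 'X) * 'X * (dotv x1 x2)%:P
   + 'X ^+ 2 * (dotv x2 x2)%:P) - ((1 - 'X) * y1%:P + 'X * y2%:P).
have [||t t01 /rootP qt0] := @poly_ivt R q 0 1; first exact: ler01.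
  by rewrite /q !hornerE; apply/andP; split; lra.
exists t => //=.
move: qt0; rewrite /q !hornerE /= dotvDl !dotvDr !dotvZl !dotvZr (dotvC x2 x1).
lra.
Qed.

End DotProduct.

Section Relaxations.
Context {R : realType} {n p : nat}.
Variables (a0 : 'cV[R]_n) (a : 'I_p -> 'cV[R]_n) (b : 'I_p -> R).

Lemma SDP_value_le_LP_value : (SDP_value a0 a b <= LP_value a0 a b)%E.
Proof.
apply: ge_ereal_sup => _ [[x Y] [_ feas _] <-]; apply: ereal_sup_ubound.
by exists (x, \tr Y).
Qed.

Lemma UQ_value_ge x : Omega1 a b x ->
  ((UQ_objective a0 x)%:E <= UQ_value a0 a b)%E.
Proof. by move=> Ox; apply: ereal_sup_ubound; exists x. Qed.

Lemma SDP_value_ge x y : (0 < n)%N -> LP_feasible a b (x, y) ->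
  dotv x x <= y -> ((LP_objective a0 (x, y))%:E <= SDP_value a0 a b)%E.
Proof.
move=> n_gt0 feas /(psd_block_exists _ _ n_gt0)[Y [symY trY psdY]].
apply: ereal_sup_ubound; exists (x, Y); first by split=> //= i; rewrite trY.
by rewrite /SDP_objective /= trY.
Qed.

Lemma SDP_value_lty : (0 < p)%N -> (SDP_value a0 a b < +oo)%E.
Proof.
move=> p_gt0; pose i := Ordinal p_gt0.
(* A single constraint suffices: [|x|^2 <= Tr Y <= 2 a_i^T x - b_i] gives
   [|x|^2 / 2 <= 2 |a_i|^2 - b_i], and the objective is at most [2 (a_i - a0)^T x - b_i <= 2 |a_i -
   a0|^2 + |x|^2 / 2 - b_i]. *)
pose M := 2 * dotv (a i - a0) (a i - a0) + 2 * dotv (a i) (a i) - 2 * b i.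
apply: (@le_lt_trans _ _ M%:E); last by rewrite ltry.
apply: ge_ereal_sup => _ [[x Y] [_ /(_ i) /= feas /psd_block_le_trace le_x] <-].
rewrite lee_fin /SDP_objective /M /=.
have := dotv_le_sqr (a i) x; have := dotv_le_sqr (a i - a0) x.
rewrite (dotvDl _ _ x) -(scaleN1r a0) (dotvZl _ a0 x); lra.
Qed.

Lemma LP_above_UQ x1 y1 x y :
  LP_feasible a b (x1, y1) -> dotv x1 x1 <= y1 ->
  (UQ_value a0 a b < (LP_objective a0 (x1, y1))%:E)%E ->
  LP_feasible a b (x, y) ->
  (UQ_value a0 a b < (LP_objective a0 (x, y))%:E)%E ->
  dotv x x <= y.
Proof.
move=> feas1 le1 gt1 feas gt; rewrite leNgt; apply/negP => /ltW lt_y.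
have [t /andP[t0 t1] /= para] := segment_paraboloid _ _ _ _ le1 lt_y.
set z := (1 - t) *: x1 + t *: x in para.
have zE c : dotv c z = (1 - t) * dotv c x1 + t * dotv c x.
  by rewrite dotvDr !dotvZr.
(* On the paraboloid the (UQ) constraints are the (LP) ones, which are affine in [(x, y)] and so
   persist along the segment. *)
have /UQ_value_ge : Omega1 a b z.
  move=> i; rewrite para zE; have := feas1 i; have := feas i => /=; nra.
apply/negP; rewrite -ltNge.
have -> : UQ_objective a0 z
    = (1 - t) * LP_objective a0 (x1, y1) + t * LP_objective a0 (x, y).
  by rewrite /UQ_objective /LP_objective para zE /=; ring.
(* A convex combination is at least the smaller of the two objectives, and both exceed v(UQ). *)
have [le_obj|lt_obj] := leP (LP_objective a0 (x1, y1)) (LP_objective a0 (x, y)).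
  by apply: (lt_le_trans gt1); rewrite lee_fin; nra.
by apply: (lt_le_trans gt); rewrite lee_fin; nra.
Qed.

End Relaxations.

Theorem theorem6 (R : realType) (n p : nat) (n_ge1 : (1 <= n)%N)
    (p_ge1 : (1 <= p)%N)
    (a0 : 'cV[R]_n) (a : 'I_p -> 'cV[R]_n) (b : 'I_p -> R)
    (slater : interior (Omega1 a b) !=set0) :
  (UQ_value a0 a b < SDP_value a0 a b)%E ->
  SDP_value a0 a b = LP_value a0 a b /\ (LP_value a0 a b < +oo)%E.
Proof.
move=> gap; suff eqv : SDP_value a0 a b = LP_value a0 a b.
  by split=> //; rewrite -eqv SDP_value_lty.
apply/eqP; rewrite eq_le SDP_value_le_LP_value /=.
have [_ [[x1 Y1] [_ feas1 /psd_block_le_trace le1] <-] gt1] := ereal_sup_gt gap.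
apply: ge_ereal_sup => _ [[x y] feas <-].
(* An (LP) value not above v(UQ) is below v(SDP) by the gap; any other comes from a point that lifts
   to (SDP). *)
have [le_UQ|gt_UQ] := leP (LP_objective a0 (x, y))%:E (UQ_value a0 a b).
  exact: le_trans le_UQ (ltW gap).
apply: SDP_value_ge => //.
exact: (LP_above_UQ a0 a b x1 (\tr Y1)).
Qed.
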